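(* Let $F:\mathbb{N}\to\mathbb{C}$ have a pure Ramanujan expansion $$F(a)=\sum_{q=1}^{\infty}\widehat{F}(q)\,c_q(a),\qquad \forall a\in\mathbb{N},$$ with coefficients $\widehat{F}:\mathbb{N}\to\mathbb{C}$ (the series converging pointwise to $F(a)$ for every $a$). Then $$F'(d)=d\sum_{K=1}^{\infty}\mu(K)\,\widehat{F}(dK),\qquad \forall d\in\mathbb{N}.$$ Furthermore, if the Ramanujan coefficients also satisfy $$\sum_{q=1}^{\infty}2^{\omega(q)}\,\bigl|\widehat{F}(q)\bigr|<\infty,$$ then they are unique, in that the Wintner coefficients $\mathrm{Win}_q(F)$ and the Carmichael coefficients $\mathrm{Car}_q(F)$ all exist and $$\widehat{F}(q)=\mathrm{Win}_q(F)=\mathrm{Car}_q(F),\qquad \forall q\in\mathbb{N}.$$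
   Context: $\mathbb{N}=\{1,2,3,\dots\}$. The Ramanujan sum is $c_q(n)=\sum_{j\le q,\ \gcd(j,q)=1}\cos(2\pi jn/q)$ for $q,n\in\mathbb{N}$. $\mu$ is the Möbius function, $\varphi$ the Euler function, and $\omega(q)$ the number of distinct prime factors of $q$. The Eratosthenes transform of $F:\mathbb{N}\to\mathbb{C}$ is $F'=F\ast\mu$ (Dirichlet convolution), so that $F(n)=\sum_{d\mid n}F'(d)$. A Ramanujan expansion $F(n)=\sum_{q=1}^\infty\widehat F(q)c_q(n)$ (pointwise convergent to $F(n)$ for all $n\in\mathbb{N}$, in the sense of convergence of the partial sums over $q\le x$ as $x\to\infty$) is called pure if all the coefficients $\widehat F(q)$ and their supports do not depend on $n$, i.e. $\widehat F$ is a function of $q$ only. The Carmichael coefficients of $F$ are $$\mathrm{Car}_q(F)=\frac{1}{\varphi(q)}\lim_{x\to\infty}\frac1x\sum_{n\le x}F(n)c_q(n),$$ defined when these limits exist in $\mathbb{C}$. The Wintner coefficients of $F$ are $$\mathrm{Win}_q(F)=\sum_{d\ge 1,\ d\equiv 0\bmod q}\frac{F'(d)}{d},$$ defined when these series converge. *)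

(* Defs.v *)
From HB Require Import structures.
From mathcomp Require Import all_boot all_order all_algebra.
From mathcomp Require Import boolp classical_sets reals constructive_ereal.
From mathcomp Require Import topology normedtype sequences trigo ereal complex.

Set Implicit Arguments.
Unset Strict Implicit.
Unset Printing Implicit Defensive.

Import Order.TTheory GRing.Theory Num.Theory numFieldNormedType.Exports.

Local Open Scope classical_set_scope.
Local Open Scope ring_scope.

(* The explicit [numClosedFieldType] annotation is what makes the norm topology
   of the complex plane canonical on [Cplx R] (it is not found on [R[i]]). *)
Definition Cplx (R : realType) : numClosedFieldType := R[i]%C.
Arguments Cplx : simpl never.

(* Arithmetic functions on {1, 2, ...} are functions on [nat] that are never
   evaluated at 0: all the sums below start at 1. *)

Definition omega (n : nat) : nat := size (primes n).

Definition moebius (n : nat) : int :=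
  if all (fun p => logn p n == 1%N) (primes n) then (-1) ^+ omega n else 0.

Definition ramanujan_sum (R : realType) (q n : nat) : R :=
  \sum_(1 <= j < q.+1 | coprime j q) cos (2 * pi * (j * n)%:R / q%:R).

Definition eratosthenes (R : realType) (F : nat -> Cplx R) (n : nat) : Cplx R :=
  \sum_(d <- divisors n) F d * (moebius (n %/ d))%:~R.

Definition psums (R : realType) (u : nat -> Cplx R) : nat -> Cplx R :=
  fun N => \sum_(1 <= k < N.+1) u k.

Definition ramanujan_expansion (R : realType) (F Fhat : nat -> Cplx R) : Prop :=
  forall a : nat, (0 < a)%N ->
    psums (fun q => Fhat q * (ramanujan_sum R q a)%:C%C) @ \oo --> F a.

Definition wintner_psums (R : realType) (F : nat -> Cplx R) (q : nat) :
    nat -> Cplx R :=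
  fun N => \sum_(1 <= d < N.+1 | (q %| d)%N) eratosthenes F d / d%:R.

(* As [lim] is total, this is meaningful only if [cvgn (wintner_psums F q)]. *)
Definition Win (R : realType) (q : nat) (F : nat -> Cplx R) : Cplx R :=
  limn (wintner_psums F q).

(* The mean over n <= x, for a real number x. *)
Definition carmichael_mean (R : realType) (F : nat -> Cplx R) (q : nat) :
    R -> Cplx R :=
  fun x => (x^-1)%:C%C *
    \sum_(1 <= n < (Num.truncn x).+1) F n * (ramanujan_sum R q n)%:C%C.

(* Likewise meaningful only if [carmichael_mean F q] converges at [+oo]. *)
Definition Car (R : realType) (q : nat) (F : nat -> Cplx R) : Cplx R :=
  (totient q)%:R^-1 * lim (carmichael_mean F q x @[x --> +oo]).

(* Main.v *)
Require Import Defs.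
From HB Require Import structures.
From mathcomp Require Import all_boot all_order all_algebra.
From mathcomp Require cyclic.
From mathcomp Require Import ring.
From mathcomp Require Import boolp classical_sets reals constructive_ereal.
From mathcomp Require Import topology normedtype sequences trigo ereal complex.
Import Order.TTheory GRing.Theory Num.Theory numFieldNormedType.Exports.
Local Open Scope classical_set_scope.
Local Open Scope ring_scope.

(** The theorem rests on Kluyver's formula [c_q(n) = \sum_(d | gcd(q, n)) d mu(q/d)]
    ([ramanujan_sumE]). It says that, as a function of [n], the Ramanujan sum [c_q]
    has Eratosthenes transform [d mu(q/d)] if [d] divides [q] and [0] otherwise
    ([ramanujan_int_transform]). The transform at [d] involves only the finitely
    many values of [F] at the divisors of [d], so it may be applied term by term
    to a merely pointwise convergent expansion:
    [F'(d) / d = \sum_(q, d | q) Fhat(q) mu(q/d)] ([cvg_eratosthenes]). Reading the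
    partial sums at the multiples of [d] gives the first claim
    ([cvg_moebius_series]).

    Both families of coefficients of the second claim are limits, in [t], of
    [\sum_r Fhat(r) a_t(r)] for an explicit kernel [a_t] with
    [|a_t(r)| <= B 2^omega(r)] and [a_t(r) -> c] if [r = q], [a_t(r) -> 0]
    otherwise. The hypothesis on [Fhat] is the dominating series that
    allows the limit to be taken inside the sum, with result [c Fhat(q)]
    ([tannery], [tannery_ramanujan]).

    - For the Wintner coefficient truncated at [N], the kernel is the sum of
      [mu(r/d)] over the [d <= N] with [q | d | r]. It is bounded by
      [\sum_(d | r) |mu(d)| = 2^omega(r)] ([sum_norm_moebius]), and for [N >= r] it
      equals [[r = q]] by the defining property of [mu]
      ([sum_moebius_quotient]); here [c = 1].
    - For the mean of [F c_q] over [n <= x], the kernel is the mean of [c_r c_q].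
      It is at most [q 2^omega(r)] because [|c_q| <= q] and the mean of [|c_r|] is
      at most [2^omega(r)] ([sum_norm_ramanujan_sum_le]). It tends to
      [phi(q) [r = q]]: the integers divisible by both [d] and [e] have density
      [1 / lcm(d, e)], so Kluyver's formula turns the limit into a double sum of
      [mu(r/d) mu(q/e) gcd(d, e)], evaluated with [gcd = \sum_(f | gcd) phi(f)]
      ([cvg_mean_ramanujan_sums]); here [c = phi(q)]. *)

(** * Sums of the Moebius function over divisors *)

Lemma primes_mul_prime p d : prime p -> ~~ (p %| d)%N -> (0 < d)%N ->
  perm_eq (primes (p * d)) (p :: primes d).
Proof.
move=> pp npd d0; apply: uniq_perm; rewrite /= ?primes_uniq ?mem_primes ?pp ?d0 ?andbT //.
by move=> r; rewrite primesM ?(prime_gt0 pp) // primes_prime // !inE.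
Qed.

Lemma moebius_mul_prime p d : prime p -> ~~ (p %| d)%N -> (0 < d)%N ->
  moebius (p * d) = - moebius d.
Proof.
move=> pp npd d0; have perm := primes_mul_prime p d pp npd d0.
have p0 := prime_gt0 pp.
rewrite /moebius /omega (perm_size perm) (perm_all _ perm) /=.
have -> : (logn p (p * d) == 1)%N.
  by rewrite lognM // logn_prime // eqxx lognE pp d0 (negPf npd).
rewrite exprS mulN1r /=; set a := all _ _; set b := all _ _.
suff -> : a = b by case: b; rewrite ?oppr0.
apply: eq_in_all => r; rewrite mem_primes => /and3P[pr _ rd].
rewrite lognM // logn_prime //; by case: (eqVneq r p) npd => // <-; rewrite rd.
Qed.

Lemma moebius_eq0 p n : prime p -> (p ^ 2 %| n)%N -> (0 < n)%N -> moebius n = 0.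
Proof.
move=> pp ppn n0; rewrite /moebius ifF //; apply/allP => /(_ p).
have pn : (p %| n)%N by apply: dvdn_trans ppn; rewrite dvdn_exp.
rewrite mem_primes pp n0 pn => /(_ isT) /eqP l1.
by move: ppn; rewrite pfactor_dvdn // l1.
Qed.

(** Only the divisors with [p]-adic valuation at most one contribute, and those of
    valuation one are the [p * d] with [p] not dividing [d]. Taking [f := moebius]
    makes the pairs cancel, taking [f := |moebius|] makes them double;
    the next two sums rest on this. *)
Lemma sum_divisors_prime_split (V : zmodType) (f : nat -> V) p n :
    prime p -> (p %| n)%N -> (0 < n)%N ->
    (forall d, (d %| n)%N -> (p ^ 2 %| d)%N -> f d = 0) ->
  \sum_(d <- divisors n) f d =
  \sum_(d <- divisors n | ~~ (p %| d)%N) (f d + f (p * d)%N).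
Proof.
move=> pp pn n0 f0; have p0 := prime_gt0 pp.
rewrite big_split /= (bigID (fun d => p %| d)%N) /= addrC; congr (_ + _).
rewrite (bigID (fun d => p ^ 2 %| d)%N) /= big_seq_cond big1 ?add0r; last first.
  by move=> d /and3P[]; rewrite -dvdn_divisors // => dn _ /f0; apply.
rewrite -[LHS]big_filter -[RHS]big_filter -(big_map (muln p) predT f).
apply: perm_big; apply: uniq_perm.
- by rewrite filter_uniq // divisors_uniq.
- rewrite map_inj_uniq ?filter_uniq ?divisors_uniq // => a b /eqP.
  by rewrite eqn_pmul2l // => /eqP.
move=> d; rewrite mem_filter -dvdn_divisors //.
apply/idP/mapP => [/andP[/andP[/dvdnP[m ->]]]|[m]]; last first.
  rewrite mem_filter -dvdn_divisors // => /andP[npm mn] ->.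
  rewrite dvdn_mulr //= -mulnn dvdn_pmul2l // npm /=.
  by rewrite Gauss_dvd ?pn // prime_coprime.
rewrite mulnC -mulnn dvdn_pmul2l // => npm pmn; exists m => //.
by rewrite mem_filter npm -dvdn_divisors // (dvdn_trans _ pmn) // dvdn_mull.
Qed.

Lemma sum_moebius n : (0 < n)%N -> \sum_(d <- divisors n) moebius d = (n == 1)%N.
Proof.
move=> n0; have [n1|n1] := leqP n 1.
  by have -> : n = 1%N by [apply/eqP; rewrite eqn_leq n1]; rewrite big_seq1.
rewrite gtn_eqF //; have pp := pdiv_prime n1.
rewrite (sum_divisors_prime_split _ _ _ _ pp (pdiv_dvd n)) //; last first.
  by move=> d dn pd; apply: (moebius_eq0 _ _ pp pd); apply: dvdn_gt0 dn.
rewrite big_seq_cond big1 // => d /andP[]; rewrite -dvdn_divisors // => dn npd.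
by rewrite moebius_mul_prime ?subrr // (dvdn_gt0 n0 dn).
Qed.

(** This is where the dominating weight [2 ^ omega] of the theorem comes from: each
    prime of [n] doubles the number of squarefree divisors, by induction on [n]
    with all the factors of one prime removed. *)
Lemma sum_norm_moebius n : (0 < n)%N ->
  \sum_(d <- divisors n) `|moebius d| = 2 ^+ omega n.
Proof.
elim/ltn_ind: n => n IH n0; have [n1|n1] := leqP n 1.
  by have -> : n = 1%N by [apply/eqP; rewrite eqn_leq n1]; rewrite big_seq1.
have pp := pdiv_prime n1; have pn := pdiv_dvd n; set p := pdiv n in pp pn.
have m0 : (0 < n`_p^')%N by apply: part_gt0.
have ndiv d : (d %| n)%N && ~~ (p %| d)%N = (d %| n`_p^')%N.
  apply/idP/idP => [/andP[dn npd]|dn].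
    move: (dn); rewrite -{1}(partnC p n0) Gauss_dvdr //.
    by rewrite p_part coprimeXr // coprime_sym prime_coprime.
  rewrite (dvdn_trans dn) ?dvdn_part //=; apply/negP => pd.
  by have := pnatP _ m0 (part_pnat _ n) p pp (dvdn_trans pd dn); rewrite !inE eqxx.
have on : omega n = (omega n`_p^')%N.+1.
  rewrite /omega -[RHS]/(size (p :: primes n`_p^'))%N; apply/perm_size/uniq_perm.
  - exact: primes_uniq.
  - by rewrite /= primes_uniq primes_part mem_filter !inE eqxx.
  move=> r; rewrite in_cons primes_part mem_filter !inE.
  by case: eqP => //= ->; rewrite mem_primes pp n0 pn.
rewrite (sum_divisors_prime_split _ _ _ _ pp pn) //; last first.
  by move=> d dn pd; rewrite (moebius_eq0 _ _ pp pd) ?normr0 // (dvdn_gt0 n0 dn).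
rewrite on exprS -IH //; last first.
  rewrite -{2}(partnC p n0) ltn_Pmull // p_part -(exp1n (logn p n)).
  by rewrite ltn_exp2r ?prime_gt1 // logn_gt0 mem_primes pp n0 pn.
rewrite mulr_sumr -big_filter.
rewrite (perm_big (divisors n`_p^')%N) /=; last first.
  apply: uniq_perm; rewrite ?filter_uniq ?divisors_uniq // => d.
  by rewrite mem_filter -!dvdn_divisors // andbC ndiv.
apply: eq_big_seq => d; rewrite -dvdn_divisors // -ndiv => /andP[dn npd].
by rewrite moebius_mul_prime ?(dvdn_gt0 n0 dn) // normrN mulr2n mulrDl !mul1r.
Qed.

Lemma big_divisors_quotient (V : nmodType) (f : nat -> V) n : (0 < n)%N ->
  \sum_(d <- divisors n) f (n %/ d)%N = \sum_(d <- divisors n) f d.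
Proof.
move=> n0; rewrite -(big_map (fun d => n %/ d)%N predT f).
have quoK d : (d %| n)%N -> (n %/ (n %/ d))%N = d.
  by move=> dn; rewrite -{1}(divnK dn) mulKn // divn_gt0 ?(dvdn_gt0 n0 dn) // dvdn_leq.
apply: perm_big; apply: uniq_perm; rewrite ?divisors_uniq //.
  rewrite map_inj_in_uniq ?divisors_uniq // => a b.
  rewrite -!dvdn_divisors // => an bn.
  by move=> ab; rewrite -(quoK a an) ab quoK.
move=> d; rewrite -dvdn_divisors //; apply/mapP/idP => [[m]|dn].
  by rewrite -dvdn_divisors // => mn ->; apply: dvdn_div.
by exists (n %/ d)%N; rewrite -?dvdn_divisors ?dvdn_div ?quoK.
Qed.

(** If [q | n] and [d = q * m], the condition [d | n] becomes [m | n / q], so this is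
    [sum_moebius] for [n / q] read through the reflection [m -> (n / q) / m]. *)
Lemma sum_moebius_quotient q n : (0 < q)%N -> (0 < n)%N ->
  \sum_(d <- divisors n | (q %| d)%N) moebius (n %/ d) = (n == q)%N.
Proof.
move=> q0 n0; have [/dvdnP[m nE]|nqn] := boolP (q %| n)%N; last first.
  rewrite big_seq_cond big1 => [|d /andP[]]; first by case: eqP nqn => // ->; rewrite dvdnn.
  by rewrite -dvdn_divisors // => dn qd; rewrite (dvdn_trans qd dn) in nqn.
have m0 : (0 < m)%N by move: n0; rewrite nE muln_gt0 => /andP[].
have -> : (n == q)%N = (m == 1)%N by rewrite nE -{2}(mul1n q) eqn_pmul2r.
rewrite -sum_moebius // -big_divisors_quotient //.
rewrite -big_filter (perm_big [seq (d * q)%N | d <- divisors m]) /=.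
  by rewrite big_map; apply: eq_bigr => d _; rewrite nE divnMr.
apply: uniq_perm; first by rewrite filter_uniq ?divisors_uniq.
  by rewrite map_inj_uniq ?divisors_uniq // => a b /eqP; rewrite eqn_pmul2r // => /eqP.
move=> d; rewrite mem_filter -dvdn_divisors //.
apply/andP/mapP => [[/dvdnP[k ->]]|[k]].
  by rewrite nE dvdn_pmul2r // => km; exists k; rewrite -?dvdn_divisors.
by rewrite -dvdn_divisors // => km ->; rewrite dvdn_mull // nE dvdn_pmul2r.
Qed.

(** * Kluyver's formula and the orthogonality of Ramanujan sums *)

Lemma big_multiples (V : nmodType) (f : nat -> V) d N : (0 < d)%N ->
  \sum_(1 <= j < N.+1 | (d %| j)%N) f j = \sum_(1 <= k < (N %/ d).+1) f (k * d)%N.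
Proof.
move=> d0; rewrite -(big_map (fun k => k * d)%N predT f) -[LHS]big_filter.
apply: perm_big; apply: uniq_perm; first by rewrite filter_uniq ?iota_uniq.
  by rewrite map_inj_uniq ?iota_uniq // => a b /eqP; rewrite eqn_pmul2r // => /eqP.
move=> j; rewrite mem_filter mem_index_iota.
apply/and3P/mapP => [[/dvdnP[k ->]]|[k]].
  rewrite muln_gt0 d0 andbT ltnS -leq_divRL // => k0 kN.
  by exists k => //; rewrite mem_index_iota k0.
rewrite mem_index_iota ltnS => /andP[k0 kN] ->.
by rewrite dvdn_mull // muln_gt0 k0 d0 ltnS -leq_divRL.
Qed.

Lemma big_divisors_gcd (V : nmodType) (f : nat -> V) j q : (0 < q)%N ->
  \sum_(d <- divisors (gcdn j q)) f d = \sum_(d <- divisors q | (d %| j)%N) f d.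
Proof.
move=> q0; rewrite -[RHS]big_filter; apply: perm_big; apply: uniq_perm.
- exact: divisors_uniq.
- by rewrite filter_uniq ?divisors_uniq.
move=> d; rewrite mem_filter -!dvdn_divisors ?gcdn_gt0 ?q0 ?orbT //.
by rewrite dvdn_gcd.
Qed.

Lemma big_divisors_range (V : nmodType) (P : pred nat) (f : nat -> V) r N :
    (0 < r)%N ->
  \sum_(1 <= d < N.+1 | P d && (d %| r)%N) f d =
  \sum_(d <- divisors r | P d && (d <= N)%N) f d.
Proof.
move=> r0; rewrite -[LHS]big_filter -[RHS]big_filter; apply: perm_big.
apply: uniq_perm; rewrite ?filter_uniq ?divisors_uniq ?iota_uniq // => d.
rewrite !mem_filter -dvdn_divisors // mem_index_iota ltnS.
case: (P d) => //=; case: (boolP (d %| r)%N); rewrite ?andbF //= => dr.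
by rewrite (dvdn_gt0 r0 dr) andbT.
Qed.

Lemma sum_totient n : (0 < n)%N -> (\sum_(d <- divisors n) totient d)%N = n.
Proof.
move=> n0; rewrite -[RHS]cyclic.sum_totient_dvd.
rewrite -(big_mkord (fun d => d %| n)%N totient) [RHS]big_ltn_cond //=.
rewrite dvd0n gtn_eqF //.
have := big_divisors_range nat predT totient n n n0; rewrite /= => ->.
rewrite big_seq_cond [RHS]big_seq_cond; apply: eq_bigl => d.
rewrite andbT; case: (boolP (d \in divisors n)) => //.
by rewrite -dvdn_divisors // => dn; rewrite dvdn_leq.
Qed.

Lemma big_uniq_pred1 (V : nmodType) (I : eqType) (s : seq I) (f : I -> V) i :
  uniq s -> \sum_(j <- s | j == i) f j = if i \in s then f i else 0.
Proof.
move=> us; rewrite -big_filter; case: ifPn => si.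
  by rewrite (filter_pred1_uniq us si) big_seq1.
rewrite big_seq big1 // => j; rewrite mem_filter => /andP[/eqP ->].
by rewrite (negPf si).
Qed.

(** Multiplying by [2 sin (t / 2)] makes the sum telescope. *)
Lemma sum_cos_arith (R : realType) (t : R) N : sin (t / 2) != 0 ->
  \sum_(1 <= j < N.+1) cos (j%:R * t) =
  (sin (N%:R * t + t / 2) - sin (t / 2)) / (2 * sin (t / 2)).
Proof.
move=> st; have s2 : 2 * sin (t / 2) != 0 by rewrite mulf_neq0 ?pnatr_eq0.
apply: (canRL (mulfK s2)); rewrite mulr_suml.
pose f j : R := sin (j%:R * t - t / 2).
rewrite (eq_bigr (fun j => f j.+1 - f j)) => [|j _].
  rewrite telescope_sumr // /f; congr (sin _ - sin _).
    by rewrite -natr1; field.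
  by rewrite mul1r; field.
rewrite /f; have -> : j.+1%:R * t - t / 2 = j%:R * t + t / 2 by rewrite -natr1; field.
by rewrite sinD sinB; ring.
Qed.

Lemma sin_pi_ratio_neq0 (R : realType) n q : (0 < q)%N -> ~~ (q %| n)%N ->
  sin (n%:R * pi / q%:R : R) != 0.
Proof.
move=> q0 nqn; have qR : q%:R != 0 :> R by rewrite pnatr_eq0 -lt0n.
rewrite (divn_eq n q) natrD natrM.
have -> : ((n %/ q)%:R * q%:R + (n %% q)%:R) * pi / q%:R =
    (n %% q)%:R * pi / q%:R + pi *+ (n %/ q) :> R by rewrite -mulr_natl; field.
rewrite (alternatingn (@sinDpi R)) mulf_neq0 ?signr_eq0 // gt_eqF //.
have r0 : (0 < n %% q)%N by rewrite lt0n -[(_ == _)%N]/(q %| n)%N.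
rewrite sin_gt0_pi // divr_gt0 ?mulr_gt0 ?ltr0n ?pi_gt0 //=.
by rewrite ltr_pdivrMr ?ltr0n // mulrC ltr_pM2l ?pi_gt0 // ltr_nat ltn_pmod.
Qed.

Lemma sum_cos_period (R : realType) q n : (0 < q)%N ->
  \sum_(1 <= j < q.+1) cos (2 * pi * (j * n)%:R / q%:R) =
  (if (q %| n)%N then q%:R else 0) :> R.
Proof.
move=> q0; have qR : q%:R != 0 :> R by rewrite pnatr_eq0 -lt0n.
case: ifP => [/dvdnP[m ->]|/negbT nqn].
  rewrite (eq_bigr (fun=> 1)) ?sumr_const_nat ?subn1 // => j _.
  have -> : 2 * pi * (j * (m * q))%:R / q%:R = 0 + pi *+ 2 *+ (j * m) :> R.
    by rewrite add0r -[RHS]mulr_natl -(mulr_natl _ 2) !natrM; field.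
  by rewrite (periodicn (@cosD2pi R)) cos0.
set t : R := 2 * pi * n%:R / q%:R.
have tE : t / 2 = n%:R * pi / q%:R by rewrite /t; field.
rewrite (eq_bigr (fun j => cos (j%:R * t))) => [|j _]; last first.
  by rewrite /t natrM; congr cos; field.
rewrite sum_cos_arith tE ?sin_pi_ratio_neq0 //.
have -> : q%:R * t + n%:R * pi / q%:R = n%:R * pi / q%:R + pi *+ 2 *+ n :> R.
  by rewrite -(mulr_natl _ n) -(mulr_natl _ 2) /t; field.
by rewrite (periodicn (@sinD2pi R)) subrr mul0r.
Qed.

(** Kluyver's closed form of the Ramanujan sum. It is integer-valued, which
    keeps its arithmetic apart from the real field in which [ramanujan_sum] is
    defined. *)
Definition ramanujan_int (q n : nat) : int :=
  \sum_(d <- divisors q | (d %| n)%N) d%:Z * moebius (q %/ d).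

(** The coprimality condition is detected by [\sum_(d | gcd(j, q)) mu(d)]. For fixed
    [d], the remaining [j] are the multiples of [d], and they contribute a complete
    cosine sum of period [q / d]. *)
Lemma ramanujan_sum_int (R : realType) q n : (0 < q)%N ->
  ramanujan_sum R q n = (ramanujan_int q n)%:~R.
Proof.
move=> q0; pose f j : R := cos (2 * pi * (j * n)%:R / q%:R).
have -> : ramanujan_sum R q n =
    \sum_(1 <= j < q.+1) \sum_(d <- divisors q | (d %| j)%N) (moebius d)%:~R * f j.
  rewrite /ramanujan_sum big_mkcond; apply: eq_bigr => j _.
  rewrite -mulr_suml -big_divisors_gcd // -rmorph_sum sum_moebius ?gcdn_gt0 ?q0 ?orbT //.
  by rewrite /coprime; case: ifP; rewrite ?mul1r ?mul0r.
rewrite (exchange_big_dep predT) //=.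
pose g d : R := (moebius (q %/ d))%:~R * (if (d %| n)%N then d%:R else 0).
have gE d : (d %| q)%N -> \sum_(1 <= j < q.+1 | (d %| j)%N) (moebius d)%:~R * f j =
    g (q %/ d)%N.
  move=> dq; have d0 := dvdn_gt0 q0 dq.
  have e0 : (0 < q %/ d)%N by rewrite divn_gt0 // dvdn_leq.
  have ed : (q %/ (q %/ d))%N = d by rewrite -{1}(divnK dq) mulKn.
  rewrite -mulr_sumr /g ed; congr (_ * _).
  rewrite big_multiples // -(sum_cos_period R (q %/ d)%N) //.
  apply: eq_bigr => k _; rewrite /f; congr cos.
  have eR : (q %/ d)%:R != 0 :> R by rewrite pnatr_eq0 -lt0n.
  have dR : d%:R != 0 :> R by rewrite pnatr_eq0 -lt0n.
  by rewrite -{1}(divnK dq) !natrM; field; rewrite eR.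
rewrite big_seq (eq_bigr (fun d => g (q %/ d)%N)) => [|d]; last first.
  by rewrite -dvdn_divisors // => /gE.
rewrite -big_seq big_divisors_quotient // /ramanujan_int rmorph_sum [RHS]big_mkcond /=.
apply: eq_bigr => d _; rewrite /g; case: ifP => _; rewrite ?mulr0 //.
by rewrite rmorphM /= mulrC.
Qed.

(** Exchanging the two sums leaves, for each divisor [e] of [q], the sum of
    [mu(d/t)] over [e | t | d], which vanishes unless [e = d]. *)
Lemma ramanujan_int_transform q d : (0 < q)%N -> (0 < d)%N ->
  \sum_(t <- divisors d) ramanujan_int q t * moebius (d %/ t) =
  if (d %| q)%N then d%:Z * moebius (q %/ d) else 0.
Proof.
move=> q0 d0; rewrite /ramanujan_int.
under eq_bigr do rewrite mulr_suml.
rewrite (exchange_big_dep predT) //=.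
rewrite big_seq (eq_bigr (fun e => if e == d then d%:Z * moebius (q %/ d) else 0)).
  by rewrite -big_seq -big_mkcond /= big_uniq_pred1 ?divisors_uniq // -dvdn_divisors.
move=> e; rewrite -dvdn_divisors // => eq; rewrite -mulr_sumr.
rewrite sum_moebius_quotient ?(dvdn_gt0 q0 eq) // eq_sym.
by case: eqP => [->|_]; rewrite ?mulr1 ?mulr0.
Qed.

(** Write [gcd(d, e)] as the sum of [phi(f)] over its divisors [f]; the sum over
    [d] then kills every [f] but [f = r]. *)
Lemma sum_moebius_gcd r e : (0 < r)%N -> (0 < e)%N ->
  \sum_(d <- divisors r) moebius (r %/ d) * (gcdn d e)%:Z =
  if (r %| e)%N then (totient r)%:Z else 0.
Proof.
move=> r0 e0.
rewrite (eq_bigr (fun d => \sum_(f <- divisors e | (f %| d)%N)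
    (totient f)%:Z * moebius (r %/ d))) => [|d _].
  rewrite (exchange_big_dep predT) //=.
  rewrite big_seq (eq_bigr (fun f => if f == r then (totient r)%:Z else 0)).
    by rewrite -big_seq -big_mkcond /= big_uniq_pred1 ?divisors_uniq // -dvdn_divisors.
  move=> f; rewrite -dvdn_divisors // => fe; rewrite -mulr_sumr.
  rewrite sum_moebius_quotient ?(dvdn_gt0 e0 fe) // eq_sym.
  by case: eqP => [->|_]; rewrite ?mulr1 ?mulr0.
rewrite -mulr_suml -big_divisors_gcd // mulrC; congr (_ * _).
by rewrite -[in LHS](sum_totient (gcdn d e)) ?gcdn_gt0 ?e0 ?orbT //
  (big_morph Posz PoszD (erefl _)).
Qed.

(** The left-hand side is the mean value of [c_r c_q], because
    [d e / lcm(d, e) = gcd(d, e)]. *)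
Lemma ramanujan_int_orthogonality r q : (0 < r)%N -> (0 < q)%N ->
  \sum_(d <- divisors r) \sum_(e <- divisors q)
     moebius (r %/ d) * moebius (q %/ e) * (gcdn d e)%:Z =
  if r == q then (totient q)%:Z else 0.
Proof.
move=> r0 q0; rewrite exchange_big /=.
rewrite big_seq (eq_bigr (fun e => moebius (q %/ e) *
    (if (r %| e)%N then (totient r)%:Z else 0))) => [|e]; last first.
  rewrite -dvdn_divisors // => eq; rewrite -sum_moebius_gcd ?(dvdn_gt0 q0 eq) //.
  by rewrite mulr_sumr; apply: eq_bigr => d _; ring.
rewrite -big_seq (eq_bigr (fun e => if (r %| e)%N then moebius (q %/ e) * (totient r)%:Z
  else 0)) => [|e _]; last by case: ifP; rewrite ?mulr0.
rewrite -big_mkcond -mulr_suml sum_moebius_quotient // [q == r]eq_sym.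
by case: eqP => [->|_]; rewrite ?mul1r ?mul0r.
Qed.

(** * Mean values of Ramanujan sums *)

Lemma cvg_count_multiples (R : realType) l : (0 < l)%N ->
  (x^-1 * (Num.truncn x %/ l)%:R : R) @[x --> +oo] --> (l%:R^-1 : R).
Proof.
move=> l0; have lR : 0 < l%:R :> R by rewrite ltr0n.
apply: (squeeze_cvgr (f := fun x : R => l%:R^-1 - x^-1) (h := fun=> l%:R^-1)).
- near=> x; have x0 : 0 < x by near: x; apply: nbhs_pinfty_gt; rewrite num_real.
  have /andP[tx xt] := truncn_itv (ltW x0); set t := Num.truncn x in tx xt *.
  have kt : ((t %/ l)%:R * l%:R <= x :> R).
    by apply: le_trans tx; rewrite -natrM ler_nat leq_trunc_div.
  have xk : (x <= (t %/ l)%:R * l%:R + l%:R :> R).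
    apply: le_trans (ltW xt) _; rewrite -natrM -natrD ler_nat.
    by rewrite -mulSnr ltn_ceil.
  apply/andP; split; last by rewrite mulrC ler_pdivrMr // mulrC ler_pdivlMr.
  have -> : l%:R^-1 - x^-1 = x^-1 * (x / l%:R - 1) by field; rewrite !gt_eqF.
  by rewrite ler_pM2l ?invr_gt0 // lerBlDr ler_pdivrMr // mulrDl mul1r.
- rewrite -[X in _ --> X]subr0; apply: cvgB; first exact: cvg_cst.
  by apply/gtr0_cvgV0; [exact: nbhs_pinfty_gt | exact: cvg_id].
- exact: cvg_cst.
Unshelve. all: by end_near. Qed.

Lemma ramanujan_sumE (R : realType) q n : (0 < q)%N ->
  ramanujan_sum R q n =
  \sum_(d <- divisors q | (d %| n)%N) d%:R * (moebius (q %/ d))%:~R.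
Proof.
move=> q0; rewrite ramanujan_sum_int // rmorph_sum /=.
by apply: eq_bigr => d _; rewrite rmorphM.
Qed.

(** Expanding both factors by Kluyver's formula leaves finitely many counts of the
    multiples of [lcm(d, e)] up to [x]. *)
Lemma cvg_mean_ramanujan_sums (R : realType) r q : (0 < r)%N -> (0 < q)%N ->
  x^-1 * (\sum_(1 <= n < (Num.truncn x).+1) ramanujan_sum R r n * ramanujan_sum R q n)
    @[x --> +oo] --> (if r == q then (totient q)%:R else 0 : R).
Proof.
move=> r0 q0.
pose c d e : R := d%:R * (moebius (r %/ d))%:~R * (e%:R * (moebius (q %/ e))%:~R).
have gcdE : (if r == q then (totient q)%:R else 0 : R) =
  \sum_(d <- divisors r | d \in divisors r) \sum_(e <- divisors q | e \in divisors q)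
    c d e * (lcmn d e)%:R^-1.
  transitivity ((if r == q then (totient q)%:Z else 0)%:~R : R); first by case: eqP.
  rewrite -ramanujan_int_orthogonality // rmorph_sum big_seq /=.
  apply: eq_bigr => d; rewrite -dvdn_divisors // => dr; rewrite rmorph_sum big_seq /=.
  apply: eq_bigr => e; rewrite -dvdn_divisors // => eq; rewrite !rmorphM /= /c.
  have l0 : (lcmn d e)%:R != 0 :> R.
    by rewrite pnatr_eq0 -lt0n lcmn_gt0 (dvdn_gt0 r0 dr) (dvdn_gt0 q0 eq).
  apply: (canRL (mulfK l0)).
  transitivity ((moebius (r %/ d))%:~R * (moebius (q %/ e))%:~R *
    (lcmn d e * gcdn d e)%:R : R); first by rewrite natrM -pmulrn; ring.
  by rewrite muln_lcm_gcd natrM; ring.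
rewrite gcdE.
have meanE x : x^-1 * (\sum_(1 <= n < (Num.truncn x).+1)
    ramanujan_sum R r n * ramanujan_sum R q n) =
  \sum_(d <- divisors r | d \in divisors r) \sum_(e <- divisors q | e \in divisors q)
    c d e * (x^-1 * (Num.truncn x %/ lcmn d e)%:R).
  under eq_bigr do rewrite !ramanujan_sumE //.
  rewrite (eq_bigr (fun n => \sum_(d <- divisors r) \sum_(e <- divisors q)
    (if (lcmn d e %| n)%N then c d e else 0))) => [|n _]; last first.
    rewrite big_mkcond [X in _ * X]big_mkcond big_distrlr /=.
    apply: eq_bigr => d _; apply: eq_bigr => e _; rewrite dvdn_lcm.
    by case: ifP => _; case: ifP; rewrite ?mulr0 ?mul0r.
  rewrite exchange_big mulr_sumr big_seq; apply: eq_bigr => d dr.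
  rewrite exchange_big mulr_sumr big_seq; apply: eq_bigr => e eq.
  rewrite -big_mkcond /= big_multiples; last first.
    move: dr eq; rewrite -!dvdn_divisors // => dr eq.
    by rewrite lcmn_gt0 (dvdn_gt0 r0 dr) (dvdn_gt0 q0 eq).
  by rewrite sumr_const_nat subn1 -mulr_natr; ring.
apply: cvg_trans; first by apply: near_eq_cvg; apply: nearW => x; exact/esym/meanE.
apply: cvg_big => [|d]; first exact: add_continuous.
rewrite -dvdn_divisors // => dr.
apply: cvg_big => [|e]; first exact: add_continuous.
rewrite -dvdn_divisors // => eq.
apply: cvgM; first exact: cvg_cst.
by apply: cvg_count_multiples; rewrite lcmn_gt0 (dvdn_gt0 r0 dr) (dvdn_gt0 q0 eq).
Qed.

Lemma norm_ramanujan_sum_le (R : realType) q n : `|ramanujan_sum R q n| <= q%:R.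
Proof.
apply: le_trans (ler_norm_sum _ _ _) _.
rewrite big_mkcond /=.
apply: (@le_trans _ _ (\sum_(1 <= j < q.+1) 1)).
  by apply: ler_sum => j _; case: ifP => // _; exact: cos_max.
by rewrite sumr_const_nat subn1.
Qed.

(** In Kluyver's formula the factor [d] is compensated by the at most [N / d]
    multiples of [d], so that only the number of squarefree divisors of [r]
    remains. *)
Lemma sum_norm_ramanujan_sum_le (R : realType) r N : (0 < r)%N ->
  \sum_(1 <= n < N.+1) `|ramanujan_sum R r n| <= 2 ^+ omega r * N%:R.
Proof.
move=> r0; pose m d : R := `|(moebius (r %/ d))%:~R|.
apply: (@le_trans _ _ (\sum_(1 <= n < N.+1) \sum_(d <- divisors r | (d %| n)%N) d%:R * m d)).
  apply: ler_sum => n _; rewrite ramanujan_sumE //.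
  apply: le_trans (ler_norm_sum _ _ _) _.
  by apply: ler_sum => d _; rewrite normrM normr_nat.
rewrite (exchange_big_dep predT) //=.
apply: (@le_trans _ _ (\sum_(d <- divisors r) m d * N%:R)).
  rewrite big_seq [leRHS]big_seq; apply: ler_sum => d; rewrite -dvdn_divisors // => dr.
  rewrite big_multiples ?(dvdn_gt0 r0 dr) // sumr_const_nat subn1 -[leLHS]mulr_natr /=.
  rewrite mulrAC mulrC ler_wpM2l ?normr_ge0 //.
  by rewrite -natrM ler_nat mulnC leq_trunc_div.
rewrite -mulr_suml ler_wpM2r //.
rewrite (big_divisors_quotient _ (fun d => `|(moebius d)%:~R|) _ r0).
rewrite (eq_bigr (fun d => `|moebius d|%:~R)) => [|d _]; last by rewrite intr_norm.
by rewrite -rmorph_sum /= sum_norm_moebius // rmorphXn.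
Qed.

(** * The Eratosthenes transform of a Ramanujan expansion *)

(** Finite linear combinations of convergent series converge term by term; this
    is all that is available for a pointwise, possibly conditional, expansion. *)
Lemma psums_cvg_sum (R : realType) (I : eqType) (s : seq I) (P : pred I)
    (u : I -> nat -> Cplx R) (l c : I -> Cplx R) :
    (forall i, i \in s -> P i -> psums (u i) @ \oo --> l i) ->
  psums (fun k => \sum_(i <- s | P i) u i k * c i) @ \oo -->
    \sum_(i <- s | P i) l i * c i.
Proof.
move=> ul.
rewrite (_ : psums _ = fun N => \sum_(i <- s | (i \in s) && P i) psums (u i) N * c i).
  rewrite [X in _ --> X]big_seq_cond.
  apply: cvg_big => [|i /andP[si Pi]]; first exact: add_continuous.
  by apply: cvgM; [exact: ul | exact: cvg_cst].
apply/funext => N; rewrite /psums exchange_big /= -big_seq_cond.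
by apply: eq_bigr => i _; rewrite mulr_suml.
Qed.

Lemma cvg_eratosthenes (R : realType) (F Fhat : nat -> Cplx R) d :
    ramanujan_expansion F Fhat -> (0 < d)%N ->
  psums (fun q => Fhat q * (if (d %| q)%N then (moebius (q %/ d))%:~R else 0)) @ \oo
    --> eratosthenes F d / d%:R.
Proof.
move=> hF d0; have dC : d%:R != 0 :> Cplx R by rewrite pnatr_eq0 -lt0n.
rewrite /eratosthenes mulr_suml.
under eq_bigr do rewrite -mulrA.
have := @psums_cvg_sum R _ (divisors d) xpredT
  (fun t q => Fhat q * (ramanujan_sum R q t)%:C%C) F
  (fun t => (moebius (d %/ t))%:~R / d%:R).
have hyp t : t \in divisors d -> xpredT t ->
    psums (fun q => Fhat q * (ramanujan_sum R q t)%:C%C) @ \oo --> F t.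
  by rewrite -dvdn_divisors // => td _; apply: hF; apply: dvdn_gt0 td.
move=> /(_ hyp); apply: cvg_trans; apply: near_eq_cvg; apply: nearW => N.
rewrite /psums big_nat [RHS]big_nat; apply: eq_bigr => q /andP[q0 _].
rewrite (eq_bigr (fun t => Fhat q / d%:R *
    (ramanujan_int q t * moebius (d %/ t))%:~R)) => [|t _].
  rewrite -mulr_sumr -rmorph_sum /= ramanujan_int_transform // -mulrA; congr (_ * _).
  by case: ifP; rewrite ?mulr0 // rmorphM /= mulKf.
rewrite ramanujan_sum_int // rmorph_int rmorphM /=; ring.
Qed.

(** The [N]-th partial sum here is the partial sum at [d * N] of the series of
    [cvg_eratosthenes], whose terms vanish off the multiples of [d]. *)
Lemma cvg_moebius_series (R : realType) (F Fhat : nat -> Cplx R) d :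
    ramanujan_expansion F Fhat -> (0 < d)%N ->
  psums (fun K => (moebius K)%:~R * Fhat (d * K)%N) @ \oo
    --> eratosthenes F d / d%:R.
Proof.
move=> hF d0; have := cvg_comp _ _ (cvg_mulnl d d0) (cvg_eratosthenes R F Fhat d hF d0).
apply: cvg_trans; apply: near_eq_cvg; apply: nearW => N; rewrite /psums /=.
transitivity (\sum_(1 <= k < (d * N).+1 | (d %| k)%N)
    Fhat k * (moebius (k %/ d))%:~R).
  by rewrite [RHS]big_mkcond; apply: eq_bigr => k _; case: ifP; rewrite ?mulr0.
rewrite big_multiples // mulKn //; apply: eq_bigr => k _.
by rewrite mulnK // mulrC mulnC.
Qed.

(** * Exchanging a limit with a dominated series *)

(** Cut at an index beyond which both the dominating tail and the tail of
    [\sum v] are small; below the cut only finitely many limits are exchanged. The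
    domination is expressed by small finite blocks of [g], so that no limit of
    [\sum g] in the field of complex numbers has to be named. *)
Lemma tannery (R : realType) (T : Type) (F : set_system T) (FF : Filter F)
    (u : T -> nat -> Cplx R) (v g : nat -> Cplx R) (G : T -> Cplx R) (L : Cplx R) :
    (forall e, 0 < e -> exists Q, forall N, \sum_(Q.+1 <= r < N) g r <= e) ->
    (\forall t \near F, (forall r, (0 < r)%N -> `|u t r| <= g r) /\
       psums (u t) @ \oo --> G t) ->
    (forall r, (0 < r)%N -> u^~ r @ F --> v r) ->
    psums v @ \oo --> L ->
  G @ F --> L.
Proof.
move=> tail ug uv vL; apply/cvgrPdist_le => e e0.
have e4 : 0 < e / 4 by rewrite divr_gt0.
have [Q tailQ] := tail _ e4.
have [M _ vM] : \forall N \near \oo, `|L - psums v N| <= e / 4.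
  by move/cvgrPdist_le: vL => /(_ _ e4).
pose Q1 := maxn Q M; have vQ1 : `|L - psums v Q1| <= e / 4 by apply: vM; apply: leq_maxr.
have uQ1 : (fun t => psums (u t) Q1) @ F --> psums v Q1.
  rewrite /psums [X in _ --> X]big_nat.
  rewrite (_ : (fun t => _) = fun t => \sum_(1 <= k < Q1.+1 | (1 <= k < Q1.+1)%N) u t k).
    by apply: cvg_big => [|k /andP[k0 _]]; [exact: add_continuous | exact: uv].
  by apply/funext => t; rewrite big_nat.
move/cvgrPdist_le: uQ1 => /(_ _ e4) uQ1.
near=> t.
have [utg utG] : (forall r, (0 < r)%N -> `|u t r| <= g r) /\ psums (u t) @ \oo --> G t.
  by near: t.
(* [G t] is reached only in the limit, so it is replaced by a partial sum of
   index [N], itself compared with the one at the cut [Q1] by domination. *)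
have [N0 _ GN] : \forall N \near \oo, `|G t - psums (u t) N| <= e / 4.
  by move/cvgrPdist_le: utG => /(_ _ e4).
pose N := maxn N0 Q1; have {}GN : `|G t - psums (u t) N| <= e / 4.
  by apply: GN; apply: leq_maxl.
have uN : `|psums (u t) N - psums (u t) Q1| <= e / 4.
  rewrite /psums (big_cat_nat (n := Q1.+1)) //=; last by rewrite ltnS leq_maxr.
  rewrite [X in `|X|](_ : _ = \sum_(Q1.+1 <= i < N.+1) u t i); last by ring.
  apply: le_trans (ler_norm_sum _ _ _) _.
  apply: le_trans (tailQ N.+1).
  rewrite [leRHS](big_cat_nat (n := Q1.+1)) ?ltnS ?leq_maxl ?leq_maxr //=.
  rewrite -[leLHS]add0r lerD //.
    rewrite big_nat sumr_ge0 // => k /andP[Qk _].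
    by apply: le_trans (utg k _); rewrite // (leq_trans _ Qk).
  rewrite big_nat [leRHS]big_nat ler_sum // => k /andP[Qk _].
  by rewrite utg // (leq_trans _ Qk).
have -> : L - G t = (L - psums v Q1) + (psums v Q1 - psums (u t) Q1)
    - (psums (u t) N - psums (u t) Q1) - (G t - psums (u t) N) by ring.
have -> : e = e / 4 + e / 4 + e / 4 + e / 4 by field.
do 3 (apply: le_trans (ler_normD _ _) _; rewrite ?normrN lerD //).
by near: t.
Unshelve. all: by end_near. Qed.

Lemma nneseries_tail_le (R : realType) (w : nat -> R) (e : Cplx R) :
    (forall q, 0 <= w q) -> (\sum_(1 <= q <oo) (w q)%:E < +oo)%E -> 0 < e ->
  exists Q, forall N, \sum_(Q.+1 <= r < N) (w r)%:C%C <= e.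
Proof.
move=> w0 woo; case: e => a b; rewrite ltcE /= => /andP[/eqP -> a0].
have woo1 : (\sum_(0 <= q <oo | (0 < q)%N) (w q)%:E < +oo)%E.
  apply: le_lt_trans woo; rewrite le_eqVlt; apply/orP; left; apply/eqP.
  congr (limn _); apply/funext => n.
  by rewrite [RHS](big_nat_widenl 1 0).
have wE0 k : (0 < k)%N -> (0 <= (w k)%:E)%E by rewrite lee_fin.
have a0E : (0 < a%:E)%E by rewrite lte_fin.
have [Q _ tailQ] := nneseries_tail_cvg woo1 wE0 (open_ereal_lt' a0E).
exists Q => N; rewrite -rmorph_sum /= lecR -lee_fin.
apply: le_trans (ltW (tailQ Q.+1 (leqnSn Q))).
apply: le_trans (nneseries_lim_ge N (fun n _ => wE0 n)).
rewrite sumEFin lee_fin big_nat_cond [leRHS]big_nat_cond le_eqVlt.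
apply/orP; left; apply/eqP; apply: eq_bigl => n; rewrite andbT.
by case: n => [|n]; rewrite ?andbT.
Qed.

Lemma norm_real_complex (R : realType) (x : R) : `|x%:C%C : Cplx R| = `|x|%:C%C.
Proof.
by rewrite -[LHS]/((ComplexField.Normc.normc x%:C%C)%:C%C) /= expr0n addr0 sqrtr_sqr.
Qed.

Lemma cvg_real_complex (R : realType) (T : Type) {F : set_system T} {FF : Filter F}
    (f : T -> R) (l : R) :
  f @ F --> l -> ((f t)%:C%C : Cplx R) @[t --> F] --> (l%:C%C : Cplx R).
Proof.
move=> fl; apply/cvgrPdist_le => -[a b]; rewrite ltcE /= => /andP[/eqP -> a0].
move/cvgrPdist_le: fl => /(_ a a0); apply: filterS => t.
by rewrite -rmorphB norm_real_complex lecR.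
Qed.

(** The form in which the summability hypothesis is used: a kernel [a t] that
    approximates [c] times the indicator of [q] extracts [c * Fhat q] from the
    expansion. *)
Lemma tannery_ramanujan (R : realType) (T : Type) (F : set_system T) (FF : Filter F)
    (Fhat : nat -> Cplx R) (a : T -> nat -> Cplx R) (B : R) (c : Cplx R) q
    (G : T -> Cplx R) :
    (\sum_(1 <= q <oo) (2 ^+ omega q * ComplexField.Normc.normc (Fhat q))%:E < +oo)%E ->
    0 < B -> (0 < q)%N ->
    (\forall t \near F,
       (forall r, (0 < r)%N -> `|a t r| <= (B * 2 ^+ omega r)%:C%C) /\
       psums (fun r => Fhat r * a t r) @ \oo --> G t) ->
    (forall r, (0 < r)%N -> a^~ r @ F --> (if r == q then c else 0)) ->
  G @ F --> Fhat q * c.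
Proof.
move=> hsum B0 q0 aG alim.
pose w r : R := 2 ^+ omega r * ComplexField.Normc.normc (Fhat r).
have normE r : `|Fhat r| = (ComplexField.Normc.normc (Fhat r))%:C%C by [].
have w0 r : 0 <= w r.
  by rewrite mulr_ge0 ?exprn_ge0 // -lecR -normE normr_ge0.
have B0C : (0 : Cplx R) < B%:C%C by rewrite ltcR.
apply: (tannery R T F FF (fun t r => Fhat r * a t r)
  (fun r => Fhat r * (if r == q then c else 0)) (fun r => B%:C%C * (w r)%:C%C)).
- move=> e e0; have eB : 0 < e / B%:C%C by rewrite divr_gt0.
  have [Q tailQ] := nneseries_tail_le R w _ w0 hsum eB.
  by exists Q => N; rewrite -mulr_sumr mulrC -ler_pdivlMr.
- apply: filterS aG => t [ab aG]; split=> // r r0.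
  have -> : B%:C%C * (w r)%:C%C = `|Fhat r| * (B * 2 ^+ omega r)%:C%C.
    by rewrite normE /w !rmorphM /=; ring.
  by rewrite normrM ler_wpM2l ?ab.
- by move=> r r0; apply: cvgM; [exact: cvg_cst | exact: alim].
- apply: cvg_near_cst; exists q => // N /= qN; rewrite /psums.
  rewrite (eq_bigr (fun r => if r == q then Fhat q * c else 0)) => [|r _].
    rewrite -big_mkcond big_nat1_eq ?q0 ?ltnS ?qN //.
  by case: eqP => [->|_]; rewrite ?mulr0.
Qed.

(** * Wintner and Carmichael coefficients *)

Lemma cvg_wintner (R : realType) (F Fhat : nat -> Cplx R) q :
    ramanujan_expansion F Fhat ->
    (\sum_(1 <= q <oo) (2 ^+ omega q * ComplexField.Normc.normc (Fhat q))%:E < +oo)%E ->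
    (0 < q)%N ->
  wintner_psums F q @ \oo --> Fhat q.
Proof.
move=> hF hsum q0; rewrite -[X in _ --> X]mulr1.
pose m r d : Cplx R := if (d %| r)%N then (moebius (r %/ d))%:~R else 0.
pose a N r : Cplx R := \sum_(1 <= d < N.+1 | (q %| d)%N) m r d.
have aE N r : (0 < r)%N ->
    a N r = \sum_(d <- divisors r | (q %| d)%N && (d <= N)%N) (moebius (r %/ d))%:~R.
  by move=> r0; rewrite -big_divisors_range // /a -big_mkcondr.
apply: (tannery_ramanujan R nat \oo _ Fhat a 1 1 q (wintner_psums F q) hsum ltr01 q0).
  apply: nearW => N; split=> [r r0|].
    rewrite aE // mul1r; apply: le_trans (ler_norm_sum _ _ _) _.
    apply: (@le_trans _ _ (\sum_(d <- divisors r) `|moebius (r %/ d)|%:~R)).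
      rewrite big_mkcond; apply: ler_sum => d _; rewrite -intr_norm; case: ifP => // _.
    rewrite -rmorph_sum /= (big_divisors_quotient _ (fun d => `|moebius d|) _ r0).
    by rewrite sum_norm_moebius // !rmorphXn /= !rmorph_nat.
  rewrite (_ : wintner_psums F q N = \sum_(1 <= d < N.+1 | (q %| d)%N)
      (eratosthenes F d / d%:R) * 1); last by apply: eq_bigr => d _; rewrite mulr1.
  have hyp d : d \in index_iota 1 N.+1 -> (q %| d)%N ->
      psums (fun r => Fhat r * m r d) @ \oo --> eratosthenes F d / d%:R.
    by rewrite mem_index_iota => /andP[d0 _] _; exact: cvg_eratosthenes.
  have := psums_cvg_sum R _ _ _ (fun d r => Fhat r * m r d) _ (fun=> 1) hyp.
  apply: cvg_trans; apply: near_eq_cvg; apply: nearW => K.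
  apply: eq_bigr => r _; rewrite mulr_sumr; apply: eq_bigr => d _.
  by rewrite mulr1.
(* Once [r <= N] the truncation no longer removes any divisor of [r]. *)
move=> r r0; apply: cvg_near_cst; exists r => // N /= rN.
rewrite aE // big_seq_cond (eq_bigl (fun d => (d \in divisors r) && (q %| d)%N)) => [|d].
  rewrite -big_seq_cond -rmorph_sum /= sum_moebius_quotient //.
  by case: eqP.
rewrite -dvdn_divisors //; case: (boolP (d %| r)%N) => //= dr.
by rewrite (leq_trans (dvdn_leq r0 dr) rN) andbT.
Qed.

Lemma cvg_carmichael (R : realType) (F Fhat : nat -> Cplx R) q :
    ramanujan_expansion F Fhat ->
    (\sum_(1 <= q <oo) (2 ^+ omega q * ComplexField.Normc.normc (Fhat q))%:E < +oo)%E ->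
    (0 < q)%N ->
  carmichael_mean F q x @[x --> +oo] --> Fhat q * (totient q)%:R.
Proof.
move=> hF hsum q0.
pose S (x : R) r : R := \sum_(1 <= n < (Num.truncn x).+1)
  ramanujan_sum R r n * ramanujan_sum R q n.
pose a (x : R) r : Cplx R := (x^-1 * S x r)%:C%C.
have q0R : 0 < q%:R :> R by rewrite ltr0n.
apply: (tannery_ramanujan R R _ _ Fhat a q%:R _ q (carmichael_mean F q) hsum q0R q0).
- near=> x; have x0 : 0 < x by near: x; apply: nbhs_pinfty_gt; rewrite num_real.
  split=> [r r0|].
    rewrite norm_real_complex lecR normrM gtr0_norm ?invr_gt0 // mulrC ler_pdivrMr //.
    apply: (@le_trans _ _ (q%:R * \sum_(1 <= n < (Num.truncn x).+1) `|ramanujan_sum R r n|)).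
      apply: le_trans (ler_norm_sum _ _ _) _; rewrite mulr_sumr; apply: ler_sum => n _.
      by rewrite normrM mulrC ler_wpM2r ?normr_ge0 ?norm_ramanujan_sum_le.
    rewrite -mulrA ler_wpM2l //; apply: le_trans (sum_norm_ramanujan_sum_le R r _ r0) _.
    rewrite ler_wpM2l ?exprn_ge0 //.
    by have /andP[] := truncn_itv (ltW x0).
  rewrite /carmichael_mean mulr_sumr.
  rewrite (eq_bigr (fun n => F n * ((ramanujan_sum R q n)%:C%C * (x^-1)%:C%C))); last first.
    by move=> n _; rewrite mulrC mulrA.
  have hyp n : n \in index_iota 1 (Num.truncn x).+1 -> xpredT n ->
      psums (fun r => Fhat r * (ramanujan_sum R r n)%:C%C) @ \oo --> F n.
    by rewrite mem_index_iota => /andP[n0 _] _; exact: hF.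
  have := psums_cvg_sum R _ _ _ (fun n r => Fhat r * (ramanujan_sum R r n)%:C%C) _
    (fun n => (ramanujan_sum R q n)%:C%C * (x^-1)%:C%C) hyp.
  apply: cvg_trans; apply: near_eq_cvg; apply: nearW => K.
  apply: eq_bigr => r _; rewrite /a /S mulr_sumr rmorph_sum mulr_sumr /=.
  by apply: eq_bigr => n _; rewrite !rmorphM /=; ring.
- move=> r r0.
  have -> : (if r == q then (totient q)%:R else 0) =
      (if r == q then (totient q)%:R else 0 : R)%:C%C :> Cplx R.
    by case: eqP => _; [exact/esym/rmorph_nat | exact/esym/rmorph0].
  apply: cvg_real_complex; exact: cvg_mean_ramanujan_sums.
Unshelve. all: by end_near. Qed.

Theorem theorem4 (R : realType) (F Fhat : nat -> Cplx R)
    (hF : ramanujan_expansion F Fhat) :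
  (forall d : nat, (0 < d)%N ->
     let S := psums (fun K => (moebius K)%:~R * Fhat (d * K)%N) in
     cvgn S /\ eratosthenes F d = d%:R * limn S)
  /\
  ((\sum_(1 <= q <oo) (2 ^+ omega q * ComplexField.Normc.normc (Fhat q))%:E < +oo)%E ->
   forall q : nat, (0 < q)%N ->
     [/\ cvgn (wintner_psums F q),
         cvg (carmichael_mean F q x @[x --> +oo]),
         Fhat q = Win q F
       & Win q F = Car q F]).
Proof.
have cvgE (T : Type) (G : set_system T) (FG : ProperFilter G) (f : T -> Cplx R) l :
    f @ G --> l -> lim (f @ G) = l by apply: cvg_lim; exact: norm_hausdorff.
split=> [d d0 S|hsum q q0].
  have Scvg : S @ \oo --> eratosthenes F d / d%:R by exact: cvg_moebius_series.
  split; first exact: cvgP Scvg.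
  by rewrite (cvgE _ _ _ _ _ Scvg) mulrC divfK // pnatr_eq0 -lt0n.
have Wcvg := cvg_wintner R F Fhat q hF hsum q0.
have Ccvg := cvg_carmichael R F Fhat q hF hsum q0.
have WinE : Win q F = Fhat q by exact: cvgE Wcvg.
split.
- exact: cvgP Wcvg.
- exact: cvgP Ccvg.
- exact: esym WinE.
rewrite WinE /Car (cvgE _ _ _ _ _ Ccvg) mulrC mulfK //.
by rewrite pnatr_eq0 -lt0n totient_gt0.
Qed.
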